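(* Let $q$ be a prime power, $u\ge 1$, $m\ge 2$, and $n_a = (q^{um}-1)/(q^u-1)$. Let $H^{q^u}_m$ be a parity check matrix of the $q^u$-ary Hamming code of length $n_a$, and let $n_b$ be an integer with $4 \leq n_b \leq (q^u-1)n_a + 1$. Let $R^q_{n_b} = [I_{n_b-1} \mid -\mathbf{1}^T]$ be the $(n_b-1)\times n_b$ parity check matrix over $\mathbb{F}_q$ of the $q$-ary repetition $[n_b,1,n_b]_q$ code. Then the linear code $C$ over $\mathbb{F}_{q^u}$ with parity check matrix $H^{q^u}_m \otimes R^q_{n_b}$: (a) is a $q^u$-ary uniformly packed (in the wide sense) $[n,k,d]_{q^u}$ code with covering radius $\rho = n_b - 1$, where $n = n_a n_b$, $k = n - m(n_b-1)$, $d = 3$; (b) is not completely regular.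
   Context: $H^{Q}_m$ is an $m \times \frac{Q^m-1}{Q-1}$ matrix over $\mathbb{F}_Q$ with nonzero, pairwise linearly independent columns. $I_{t}$ is the identity matrix and $\mathbf 1$ the all-ones row vector. The Kronecker product $A\otimes B$ replaces each entry $a_{r,s}$ of $A$ by $a_{r,s}B$. Covering radius $\rho=\max_{\mathbf v}d(\mathbf v,C)$ (Hamming distance). A $Q$-ary code $C$ of length $n$ with covering radius $\rho$ is uniformly packed in the wide sense if there are rational numbers $\alpha_0,\ldots,\alpha_\rho$ with $\sum_{k=0}^{\rho}\alpha_k f_k(\mathbf v)=1$ for all $\mathbf v\in\mathbb{F}_Q^n$, where $f_k(\mathbf v)$ is the number of codewords at distance $k$ from $\mathbf v$. With $C(i)=\{\mathbf x: d(\mathbf x,C)=i\}$, $C$ is completely regular if for each $l\ge0$ every $\mathbf x\in C(l)$ has the same number of neighbors (vectors at distance 1) in $C(l-1)$ and the same number of neighbors in $C(l+1)$. *)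

(* Defs.v *)
From HB Require Import structures.
From mathcomp Require Import all_boot all_order all_algebra all_field.
From mathcomp.real_closed Require Export mxtens.

Set Implicit Arguments.
Unset Strict Implicit.
Unset Printing Implicit Defensive.

Import GRing.Theory.
Local Open Scope ring_scope.

Section Codes.

Variables (F : finFieldType) (n : nat).
Implicit Types (C : {set 'rV[F]_n}) (x y v : 'rV[F]_n).

Definition hamming_dist x y : nat := #|[set i : 'I_n | x 0 i != y 0 i]|.

(* The default value n is never smaller than a Hamming distance, so for
   nonempty C this is the minimum of hamming_dist x c over c \in C. *)
Definition dist_to_code x C : nat :=
  \big[minn/n]_(c in C) hamming_dist x c.

Definition covering_radius C : nat := \max_(v : 'rV[F]_n) dist_to_code v C.

Definition min_distance_is C (d : nat) : Prop :=
  (exists x y, [/\ x \in C, y \in C, x != y & hamming_dist x y = d]) /\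
  (forall x y, x \in C -> y \in C -> x != y -> (d <= hamming_dist x y)%N).

(* [n, k, d] code: the length n is carried by the type of C. *)
Definition linear_code_params C (k d : nat) : Prop :=
  (exists V : {vspace 'rV[F]_n}, C =i V /\ \dim V = k) /\ min_distance_is C d.

Definition codewords_at C (k : nat) v : nat :=
  #|[set c in C | hamming_dist v c == k]|.

Definition uniformly_packed_wide C : Prop :=
  exists alpha : 'I_(covering_radius C).+1 -> rat,
    forall v, \sum_k alpha k * (codewords_at C k v)%:R = 1.

(* C(i), indexed by int so that C(-1) is empty. *)
Definition code_shell C (i : int) : {set 'rV[F]_n} :=
  [set x | (dist_to_code x C)%:Z == i].

Definition neighbors_in (A : {set 'rV[F]_n}) x : nat :=
  #|[set y in A | hamming_dist x y == 1%N]|.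

Definition completely_regular C : Prop :=
  forall (l : nat) x y, x \in code_shell C l%:Z -> y \in code_shell C l%:Z ->
    neighbors_in (code_shell C (l%:Z - 1)) x
      = neighbors_in (code_shell C (l%:Z - 1)) y
    /\ neighbors_in (code_shell C (l%:Z + 1)) x
      = neighbors_in (code_shell C (l%:Z + 1)) y.

Definition parity_check_code (r : nat) (H : 'M[F]_(r, n)) : {set 'rV[F]_n} :=
  [set x | H *m x^T == 0].

(* Column condition only; such an H is a parity check matrix of the Hamming
   code when moreover n = (Q^m - 1) / (Q - 1), with Q = #|F|. *)
Definition hamming_columns (m : nat) (H : 'M[F]_(m, n)) : Prop :=
  (forall j, col j H != 0) /\
  (forall i j, i != j -> free [:: col i H; col j H]).

End Codes.

(* The matrix [I | -1^T], see repetition_pcmE. *)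
Definition repetition_pcm (R : pzRingType) (n : nat) : 'M[R]_(n - 1, n) :=
  \matrix_(i < n - 1, j < n)
    if (j < n - 1)%N then (i == j :> nat)%:R else -1.

Lemma repetition_pcmE (R : pzRingType) (t : nat) :
  repetition_pcm R t.+1 =
  castmx (esym (subn1 t.+1), addn1 t) (row_mx 1%:M (- const_mx 1)).
Proof.
apply/matrixP=> i j; rewrite castmxE !mxE.
have ltE k : (k < t.+1 - 1)%N = (k < t)%N by rewrite subn1.
case: splitP => k /= kE; rewrite !mxE kE ltE.
  by rewrite ltn_ord.
by rewrite ltnNge leq_addr.
Qed.

(* Main.v *)
Require Import Defs.
From HB Require Import structures.
From mathcomp Require Import all_boot all_order all_algebra all_field.
From mathcomp Require Import zify.

(** Split a word of length [na * nb] into [nb] blocks of length [na] and let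
    [s_j] be the Hamming syndrome of the [j]-th block.  The code consists of the
    words all of whose [s_j] are equal.  As the Hamming code is perfect, changing
    one letter of the word amounts to changing exactly one [s_j] to an arbitrary
    other vector, each change arising once.  Hence distances to the code are
    those of the tuple [s] to the constant tuples over an alphabet of size
    [#|F| ^ m]; writing [d_t] for the number of [j] with [s_j <> t], the distance
    to the code is the minimum of the [d_t].

    Uniform packing.  Counting the codewords at distance [k] from the neighbours
    of [v] gives a three-term recurrence for [f_k], which shows
    [f_k v = \sum_t psi_k (d_t)] with [psi_k r = 0] for [r > k] and
    [psi_k k = 1].  By triangularity every [\sum_t phi (d_t)] with [phi] supported
    on [r < nb] is a combination of [f_0], ..., [f_(nb - 1)]; take
    [phi r = (nb - r) / nb] and use [\sum_t (nb - d_t) = nb].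

    Failure of complete regularity.  At distance [nb - 2] from the code, the
    number of neighbours closer to the code is [nb - 2] times the number of
    values taken twice by [s], which can be one or two as [nb >= 4]. *)

Set Implicit Arguments.
Unset Strict Implicit.
Unset Printing Implicit Defensive.

Import Order.TTheory GRing.Theory Num.Theory.

Local Open Scope ring_scope.

(** * Tuples over an alphabet and their distances to constant tuples *)

Section HammingGraph.

Variables (I : finType) (W : finZmodType).
Implicit Types (s : {ffun I -> W}) (t w : W).

(** With [t = 0] this is the Hamming weight, so one neighbour count serves both words over a field
    and tuples of syndromes. *)
Definition dist_const t s : nat := #|[set j | s j != t]|.

Definition shift_at s j w : {ffun I -> W} :=
  [ffun k => if k == j then s k + w else s k].

Lemma shift_atE s j w k :
  shift_at s j w k = if k == j then s k + w else s k.
Proof. by rewrite ffunE. Qed.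

Lemma dist_const_le t s : (dist_const t s <= #|I|)%N.
Proof. exact: max_card. Qed.

Lemma dist_const_compl t s :
  #|[set j | s j == t]| = (#|I| - dist_const t s)%N.
Proof.
rewrite /dist_const; have -> : [set j | s j == t] = ~: [set j | s j != t].
  by apply/setP=> j; rewrite !inE negbK.
by rewrite cardsCs setCK.
Qed.

(** Double counting: each index [j] agrees with exactly one constant, namely [s j]. *)
Lemma sum_dist_const_compl s :
  (\sum_t (#|I| - dist_const t s) = #|I|)%N.
Proof.
under eq_bigr do rewrite -dist_const_compl -sum1dep_card big_mkcond.
rewrite exchange_big -[RHS]sum1_card; apply: eq_bigr => j _.
by rewrite -big_mkcond (big_pred1 (s j)) // => t; rewrite eq_sym.
Qed.

Lemma dist_const_shift t s j w :
  (dist_const t (shift_at s j w) + (s j != t)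
   = dist_const t s + (s j + w != t)%R)%N.
Proof.
rewrite /dist_const (cardsD1 j [set i | shift_at s j w i != t]).
rewrite (cardsD1 j [set i | s i != t]) !inE ffunE eqxx.
have -> : [set i | shift_at s j w i != t] :\ j = [set i | s i != t] :\ j.
  by apply/setP => k; rewrite !inE ffunE; case: eqP.
by rewrite [LHS]addnC [(_ + #|_|)%N in LHS]addnC addnA.
Qed.

(** An index agreeing with [t] is moved away by every nonzero shift. At a disagreeing index the
    single shift [t - s j] restores agreement, and the other [#|W| - 2] leave the distance as it
    is. *)
Lemma sum_dist_const_shift (R : pzRingType) (psi : nat -> R) t s :
  let r := dist_const t s in
  \sum_j \sum_(w | w != 0) psi (dist_const t (shift_at s j w)) =
  psi r.+1 *+ ((#|I| - r) * #|W|.-1) + psi r.-1 *+ r + psi r *+ (r * #|W|.-2).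
Proof.
move=> r; rewrite (bigID (fun j => s j == t)) /=.
have -> : \sum_(j | s j == t)
    \sum_(w | w != 0) psi (dist_const t (shift_at s j w)) =
    psi r.+1 *+ ((#|I| - r) * #|W|.-1).
  rewrite (eq_bigr (fun=> psi r.+1 *+ #|W|.-1)).
    by rewrite sumr_const -[#|_|]cardsE dist_const_compl -mulrnA mulnC.
  move=> j /eqP sj; rewrite (eq_bigr (fun=> psi r.+1)).
    by rewrite sumr_const -(cardC1 (0 : W)).
  move=> w w0; congr psi; have := dist_const_shift t s j w.
  by rewrite sj eqxx -subr_eq0 addrC addKr w0 /r; lia.
rewrite -addrA; congr (_ + _).
rewrite (eq_bigr (fun=> psi r.-1 + psi r *+ #|W|.-2)).
  by rewrite sumr_const -[#|_|]cardsE -/(dist_const t s) -/r mulrnDl -mulrnA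
    mulnC.
move=> j sj; rewrite (bigD1 (t - s j)) /=; last by rewrite subr_eq0 eq_sym.
congr (_ + _).
  congr psi; have := dist_const_shift t s j (t - s j).
  by rewrite (addrC (s j)) subrK eqxx sj /r; lia.
rewrite (eq_bigr (fun=> psi r)).
  rewrite sumr_const; congr (_ *+ _).
  have h : t - s j != 0 by rewrite subr_eq0 eq_sym.
  have /= := cardC1 (0 : W).
  by rewrite (cardD1 (t - s j)) inE /= h => <-; apply: eq_card => w;
    rewrite !inE andbC.
move=> w /andP[w0 wt]; congr psi; have := dist_const_shift t s j w.
have -> : s j + w != t by apply: contra wt => /eqP <-; rewrite addrC addKr.
by rewrite sj /r; lia.
Qed.

End HammingGraph.

(** * Neighbours of a word and a recurrence for codeword counts *)

Section Neighbors.

Variables (F : finFieldType) (n : nat).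
Implicit Types (x y c : 'rV[F]_n).

Lemma hamming_distE x c :
  hamming_dist x c = dist_const 0 [ffun p => x 0 p - c 0 p].
Proof. by apply: eq_card => p; rewrite !inE ffunE subr_eq0. Qed.

Lemma hamming_dist_eq0 x y : (hamming_dist x y == 0%N) = (x == y).
Proof.
rewrite cards_eq0; apply/eqP/eqP => [h|->]; last first.
  by apply/setP=> p; rewrite !inE eqxx.
apply/rowP=> p; apply/eqP; have /setP/(_ p) := h.
by rewrite !inE => /negbFE.
Qed.

(** Correct one differing position. The last clause, that this position then agrees with [c], forces
    a second correction to fall elsewhere. *)
Lemma hamming_distS x c k : hamming_dist x c = k.+1 ->
  exists p a, [/\ a != 0, hamming_dist (x + a *: delta_mx 0 p) c = k
                & x 0 p + a = c 0 p].
Proof.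
move=> xc; have /card_gt0P[p] : (0 < #|[set i | x 0%R i != c 0%R i]|)%N.
  by rewrite [#|_|]xc.
rewrite inE => xcp; exists p, (c 0 p - x 0 p).
rewrite subr_eq0 eq_sym xcp (addrC (x 0 p)) subrK; split=> //.
move: xc; rewrite /hamming_dist (cardsD1 p) inE xcp => -[<-].
apply: eq_card => i; rewrite !inE !mxE eqxx /=; case: (i =P p) => [->|_] /=.
  by rewrite mulr1 (addrC (x 0 p)) subrK eqxx.
by rewrite mulr0 addr0.
Qed.

Lemma hamming_dist_delta x p a : a != 0 ->
  hamming_dist x (x + a *: delta_mx 0 p) = 1%N.
Proof.
move=> a0; rewrite -[RHS](cards1 p); apply: eq_card => i.
rewrite !inE !mxE eqxx /= -subr_eq0 opprD addNKr oppr_eq0 mulf_eq0 negb_or a0.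
by case: (i == p); rewrite ?oner_eq0 ?eqxx.
Qed.

Lemma sum_neighbors (V : nmodType) (g : 'rV[F]_n -> V) x :
  \sum_(y | hamming_dist x y == 1%N) g y =
  \sum_p \sum_(a | a != 0) g (x + a *: delta_mx 0 p).
Proof.
rewrite pair_big_dep /= .
pose D := [set pa : 'I_n * F | pa.2 != 0].
pose h (pa : 'I_n * F) := x + pa.2 *: delta_mx 0 pa.1.
have hinj : {in D &, injective h}.
  move=> [p a] [p' a']; rewrite !inE /= => a0 a'0 /addrI /rowP /= e.
  have := e p; rewrite !mxE !eqxx /= mulr1; case: eqP => [<-|_].
    by rewrite mulr1 => ->.
  by rewrite mulr0 => /eqP; rewrite (negPf a0).
rewrite -(eq_bigl _ _ (fun pa => in_set (fun pa : 'I_n * F => pa.2 != 0) pa)).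
rewrite -/D -(big_imset g hinj); apply: eq_bigl => y.
apply/eqP/imsetP => [|[[p a]]]; last first.
  by rewrite inE /= => a0 ->; exact: hamming_dist_delta.
move=> /hamming_distS[p [a [a0 /eqP]]]; rewrite hamming_dist_eq0 => /eqP <- _.
by exists (p, a); rewrite ?inE.
Qed.

Lemma sum_hamming_dist_neighbors (R : pzRingType) (psi : nat -> R) x c :
  let r := hamming_dist x c in
  \sum_(y | hamming_dist x y == 1%N) psi (hamming_dist y c) =
  psi r.+1 *+ ((n - r) * #|F|.-1) + psi r.-1 *+ r + psi r *+ (r * #|F|.-2).
Proof.
move=> r; rewrite sum_neighbors.
have := sum_dist_const_shift psi 0 [ffun p => x 0 p - c 0 p].
rewrite -hamming_distE /= -/r card_ord => <-.
apply: eq_bigr => p _; apply: eq_bigr => a _; congr psi.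
rewrite hamming_distE; congr dist_const; apply/ffunP => k; rewrite !ffunE !mxE.
by rewrite eqxx /=; case: eqP => _; rewrite ?mulr1 ?mulr0 ?addr0 // addrAC.
Qed.

Lemma codewords_atE (R : pzRingType) (C : {set 'rV[F]_n}) k x :
  (codewords_at C k x)%:R = \sum_(c in C) (hamming_dist x c == k)%:R :> R.
Proof.
rewrite /codewords_at -sum1_card natr_sum (eq_bigl _ _ (fun c => in_set _ c))
  big_mkcondr /=.
by apply: eq_bigr => c _; case: eqP.
Qed.

(** A codeword at distance [k] from a neighbour of [x] is at distance [k - 1], [k] or [k + 1] from
    [x]; the last case is isolated. The factor [0 < k] deletes the [k.-1] term at [k = 0], where the
    predecessor truncates. *)
Lemma codewords_at_rec (C : {set 'rV[F]_n}) k x :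
  (codewords_at C k.+1 x)%:R *+ k.+1 =
  \sum_(y | hamming_dist x y == 1%N) (codewords_at C k y)%:R
  - (codewords_at C k x)%:R *+ (k * #|F|.-2)
  - (codewords_at C k.-1 x)%:R *+ ((0 < k) * ((n - k.-1) * #|F|.-1)) :> rat.
Proof.
under [\sum_(y | _) _]eq_bigr do rewrite codewords_atE.
rewrite exchange_big !codewords_atE -!sumrMnl -!sumrB; apply: eq_bigr => c _.
have /= -> := sum_hamming_dist_neighbors (fun r => (r == k)%:R : rat) x c.
set r := hamming_dist x c.
have -> : (r.-1 == k)%:R *+ r = (r == k.+1)%:R *+ k.+1 :> rat.
  case: r => [|r] /=; first by rewrite mulr0n mul0rn.
  by rewrite eqSS; case: eqP => [->|]; rewrite ?mul0rn.
have -> : (r == k)%:R *+ (r * #|F|.-2) = (r == k)%:R *+ (k * #|F|.-2) :> rat.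
  by case: eqP => [->|]; rewrite ?mul0rn.
have -> : (r.+1 == k)%:R *+ ((n - r) * #|F|.-1) =
   (r == k.-1)%:R *+ ((0 < k) * ((n - k.-1) * #|F|.-1)) :> rat.
  case: k => [|k] /=; first by rewrite mul0n mulr0n mul0rn.
  by rewrite mul1n eqSS; case: eqP => [->|]; rewrite ?mul0rn.
by rewrite addrK addrAC subrr add0r.
Qed.

End Neighbors.

(** * The repetition matrix and sums over Kronecker indices *)

Lemma map_repetition_pcm (R S : pzRingType) (f : {rmorphism R -> S}) n :
  map_mx f (repetition_pcm R n) = repetition_pcm S n.
Proof.
apply/matrixP => i j; rewrite !mxE; case: ifP => _; first by rewrite rmorph_nat.
by rewrite rmorphN1.
Qed.

Lemma repetition_pcm_sum (R : pzRingType) b (y : 'I_b.+1 -> R)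
    (p : 'I_(b.+1 - 1)) :
  \sum_j repetition_pcm R b.+1 p j * y j =
  y (widen_ord (leq_subr _ _) p) - y ord_max.
Proof.
have pb : (p < b)%N by apply: leq_trans (ltn_ord p) _; rewrite subn1.
rewrite (bigD1 ord_max) // (bigD1 (widen_ord (leq_subr _ _) p)) /=; last first.
  by rewrite -val_eqE /= ltn_eqF.
rewrite big1 ?addr0.
  rewrite !mxE /= eqxx (ltn_ord p) mul1r ifN ?mulN1r 1?addrC //.
  by rewrite subn1 ltnn.
move=> j /andP[jm jp]; rewrite mxE ifT; last first.
  rewrite [(_ - _)%N]subn1 /= ltn_neqAle -ltnS ltn_ord andbT.
  by apply: contra jm => /eqP e; apply/eqP/val_inj.
by move: jp; rewrite -val_eqE /= eq_sym => /negPf ->; rewrite mul0r.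
Qed.

Lemma sum_mxtens (V : nmodType) a b (f : 'I_(a * b) -> V) :
  \sum_k f k = \sum_j \sum_i f (mxtens_index (i, j)).
Proof.
rewrite exchange_big pair_big /=.
rewrite (reindex (@mxtens_index a b)) /=; last first.
  by exists (@mxtens_unindex a b) => ? _;
    rewrite ?mxtens_indexK ?mxtens_unindexK.
by apply: eq_bigr => -[].
Qed.

(** * Multiples of the Hamming columns and perfection *)

Section Perfect.

Variables (F : finFieldType) (m na : nat) (H : 'M[F]_(m, na)).
Hypothesis hH : hamming_columns H.

Lemma hamming_columns_inj i j a b :
  a != 0 -> a *: col i H = b *: col j H -> i = j /\ a = b.
Proof.
case: hH => nz fr a0 e; have [ij|/fr] := eqVneq i j; last first.
  rewrite free_cons span_seq1 => /andP[/vlineP[]]; exists (a^-1 * b).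
  by rewrite -scalerA -e scalerA mulVf // scale1r.
split=> //; apply/eqP; move/eqP: e; rewrite ij -subr_eq0 -scalerBl scaler_eq0.
by rewrite (negPf (nz j)) orbF subr_eq0.
Qed.

Hypothesis hcard : (na * #|F|.-1 = (#|F| ^ m).-1)%N.

Let D := [set ia : 'I_na * F | ia.2 != 0].
Let h (ia : 'I_na * F) := ia.2 *: col ia.1 H.

Let h_inj : {in D &, injective h}.
Proof.
move=> [i a] [j b]; rewrite !inE /= => a0 _ /(hamming_columns_inj a0).
by case=> /= -> ->.
Qed.

(** Injectivity yields [na * (#|F| - 1)] distinct nonzero vectors, and by [hcard] there are no
    others. *)
Let hamming_columns_imset : h @: D = [set~ 0].
Proof.
apply/eqP; rewrite eqEcard; apply/andP; split.
  apply/subsetP => w /imsetP[[i a]]; rewrite !inE /= => a0 ->.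
  by rewrite scaler_eq0 negb_or a0 (proj1 hH).
rewrite cardsC1 card_mx muln1 card_in_imset // -hcard.
have -> : D = setX setT [set~ 0].
  by apply/setP=> -[i a]; rewrite !inE.
by rewrite cardsX cardsT card_ord cardsC1.
Qed.

Lemma sum_hamming_columns (V : nmodType) (g : 'cV[F]_m -> V) :
  \sum_i \sum_(a | a != 0) g (a *: col i H) = \sum_(w | w != 0) g w.
Proof.
rewrite pair_big_dep /=.
rewrite -(eq_bigl _ _ (fun ia => in_set (fun ia : 'I_na * F => ia.2 != 0) ia)).
rewrite -/D -(big_imset g h_inj) hamming_columns_imset.
by apply: eq_bigl => w; rewrite !inE.
Qed.

Lemma hamming_column_decode (w : 'cV[F]_m) : w != 0 ->
  exists i a, a != 0 /\ w = a *: col i H.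
Proof.
rewrite -in_setC1 -hamming_columns_imset => /imsetP[[i a]].
by rewrite inE /= => a0 ->; exists i, a.
Qed.

(** A coset leader of weight at most one. The weight is written as a sum of Booleans so that it adds
    up over blocks. *)
Lemma hamming_decode (w : 'cV[F]_m) :
  exists r : {ffun 'I_na -> F},
    \sum_i r i *: col i H = w /\ (\sum_i (r i != 0%R) = (w != 0%R))%N.
Proof.
have [->|/hamming_column_decode[i [a [a0 ->]]]] := eqVneq w 0.
  exists [ffun=> 0]; split; rewrite big1 // => i _; rewrite ffunE ?scale0r //.
  by rewrite eqxx.
exists [ffun k => if k == i then a else 0]; split.
  rewrite (bigD1 i) //= big1 ?addr0 ?ffunE ?eqxx // => k /negPf ki.
  by rewrite ffunE ki scale0r.
rewrite (bigD1 i) //= big1 ?addn0 ?ffunE ?eqxx ?a0 //.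
by move=> k /negPf ki; rewrite ffunE ki eqxx.
Qed.

End Perfect.

Lemma exists_avoid2 n (i j : 'I_n) : (2 < n)%N -> exists k, k != i /\ k != j.
Proof.
move=> n2; have /card_gt0P[k] : (0 < #|~: [set i; j]|)%N.
  by have := cardsC [set i; j]; rewrite cards2 card_ord; case: (i != j) => /=;
    lia.
by rewrite !inE negb_or => /andP[]; exists k.
Qed.

(** * Block syndromes and distances to the code *)

Section Syndrome.

Variables (F : finFieldType) (m na b : nat) (H : 'M[F]_(m, na)).

Local Notation nb := b.+1.
Local Notation C := (parity_check_code (H *t repetition_pcm F nb)).
Implicit Types (x y c v : 'rV[F]_(na * nb)) (s : {ffun 'I_nb -> 'cV[F]_m}).

(** The second Kronecker factor indexes the blocks, so block [j] occupies the positions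
    [mxtens_index (i, j)]. *)
Definition syndrome x : {ffun 'I_nb -> 'cV[F]_m} :=
  [ffun j => \sum_i x 0 (mxtens_index (i, j)) *: col i H].

(** [H] acts inside each block, and row [p] of the repetition matrix then compares block [p] with
    the last block. *)
Lemma pcm_mul_syndrome x r p :
  (H *t repetition_pcm F nb *m x^T) (mxtens_index (r, p)) 0 =
  syndrome x (widen_ord (leq_subr _ _) p) r 0 - syndrome x ord_max r 0.
Proof.
rewrite -(repetition_pcm_sum (fun j => syndrome x j r 0)) mxE sum_mxtens.
apply: eq_bigr => j _; rewrite ffunE summxE mulr_sumr; apply: eq_bigr => i _.
by rewrite tensmxE !mxE [RHS]mulrA [RHS]mulrC [RHS]mulrA.
Qed.

Lemma mem_codeP x :
  reflect (exists t, forall j, syndrome x j = t) (x \in C).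
Proof.
rewrite inE; apply: (iffP eqP) => [/matrixP h|[t h]]; last first.
  apply/matrixP => k z; rewrite ord1; case: (mxtens_indexP k) => r p.
  by rewrite pcm_mul_syndrome !h subrr mxE.
exists (syndrome x ord_max) => j; apply/colP => r.
have [->//|jm] := eqVneq j ord_max.
have jb : (j < nb - 1)%N.
  rewrite subn1 /= ltn_neqAle -ltnS ltn_ord andbT.
  by apply: contra jm => /eqP e; apply/eqP/val_inj.
have := h (mxtens_index (r, Ordinal jb)) 0;
  rewrite pcm_mul_syndrome mxE => /eqP.
by rewrite subr_eq0 => /eqP <-; congr (syndrome x _ _ _); apply: val_inj.
Qed.

Lemma syndrome_delta x i j a :
  syndrome (x + a *: delta_mx 0 (mxtens_index (i, j))) =
  shift_at (syndrome x) j (a *: col i H).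
Proof.
apply/ffunP => k; rewrite !ffunE.
transitivity (\sum_i0 x 0 (mxtens_index (i0, k)) *: col i0 H
   + \sum_(i0 | (i0 == i) && (k == j)) a *: col i0 H).
  rewrite [X in _ = _ + X]big_mkcond -big_split; apply: eq_bigr => i0 _.
  rewrite !mxE eqxx /= scalerDl (can_eq (@mxtens_indexK _ _)) xpair_eqE.
  by case: ifP => _; rewrite ?mulr1 // mulr0 scale0r.
case: eqP => _; first by under [X in _ + X]eq_bigl do rewrite andbT;
  rewrite big_pred1_eq.
by under [X in _ + X]eq_bigl do rewrite andbF; rewrite big_pred0_eq addr0.
Qed.

Lemma syndrome_dist_le x y :
  (#|[set j | syndrome x j != syndrome y j]| <= hamming_dist x y)%N.
Proof.
apply: leq_trans (leq_imset_card (fun k => (mxtens_unindex k).2) _).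
apply/subset_leq_card/subsetP => j; rewrite inE => sj; apply/imsetP.
have [i xi|e] := pickP (fun i => x 0 (mxtens_index (i, j)) != y 0
  (mxtens_index (i, j))).
  by exists (mxtens_index (i, j)); rewrite ?inE // mxtens_indexK.
case/eqP: sj; rewrite !ffunE; apply: eq_bigr => i _.
by have /negbFE/eqP-> := e i.
Qed.

Hypothesis hH : hamming_columns H.
Hypothesis hcard : (na * #|F|.-1 = (#|F| ^ m).-1)%N.

Lemma sum_neighbors_syndrome (V : nmodType)
    (g : {ffun 'I_nb -> 'cV[F]_m} -> V) x :
  \sum_(y | hamming_dist x y == 1%N) g (syndrome y) =
  \sum_j \sum_(w | w != 0) g (shift_at (syndrome x) j w).
Proof.
rewrite sum_neighbors sum_mxtens; apply: eq_bigr => j _.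
rewrite -(sum_hamming_columns hH hcard); apply: eq_bigr => i _.
by apply: eq_bigr => a _; rewrite syndrome_delta.
Qed.

(** Each block is corrected by at most one letter, so the bound of [syndrome_dist_le] is attained
    for every target tuple. *)
Lemma exists_syndrome_dist x s :
  exists y, syndrome y = s /\
    hamming_dist x y = #|[set j | syndrome x j != s j]|.
Proof.
have /fin_all_exists[r hr] := fun j => hamming_decode hH hcard (s j - syndrome
  x j).
exists (\row_k (x 0 k + r (mxtens_unindex k).2 (mxtens_unindex k).1)); split.
  apply/ffunP => j; rewrite ffunE.
  under eq_bigr do rewrite mxE mxtens_indexK /= scalerDl.
  by rewrite big_split /= (hr j).1 ffunE addrC subrK.
rewrite /hamming_dist -!sum1dep_card !(big_mkcond (fun k => _ != _)).
rewrite sum_mxtens; apply: eq_bigr => j _.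
rewrite -[RHS]/(nat_of_bool (_ != _)) (eq_sym (syndrome x j)).
rewrite -(subr_eq0 (s j)) -(hr j).2.
apply: eq_bigr => i _.
by rewrite mxE mxtens_indexK /= -subr_eq0 opprD addNKr oppr_eq0; case: eqP.
Qed.

Lemma exists_syndrome s : exists x, syndrome x = s.
Proof. by have [y [<- _]] := exists_syndrome_dist 0 s; exists y. Qed.

Lemma dist_to_code_le x t : (dist_to_code x C <= dist_const t (syndrome x))%N.
Proof.
have [c [sc dc]] := exists_syndrome_dist x [ffun=> t].
have cC : c \in C by apply/mem_codeP; exists t => j; rewrite sc ffunE.
have -> : dist_const t (syndrome x) = hamming_dist x c.
  by rewrite dc; apply: eq_card => j; rewrite !inE [[ffun=> t] j]ffunE.
by rewrite /dist_to_code -minEnat -leEnat; exact: bigmin_le_cond.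
Qed.

Lemma dist_to_codeP x :
  exists t, dist_to_code x C = dist_const t (syndrome x).
Proof.
(* A codeword is exhibited so that the minimum is attained in the code and not merely by the default
   value [na * nb]. *)
have [c0 sc0] := exists_syndrome [ffun=> 0].
have c0C : c0 \in C by apply/mem_codeP; exists 0 => j; rewrite sc0 ffunE.
have [|c cC e] := @eq_bigmin _ _ _ (na * nb)%N c0 [in C] (hamming_dist x) c0C.
  by move=> c _; apply: leq_trans (max_card _) _; rewrite card_ord.
have /mem_codeP[t ct] := cC; exists t; apply/eqP;
  rewrite eqn_leq dist_to_code_le.
rewrite {1}/dist_to_code -minEnat e.
have -> : dist_const t (syndrome x) = #|[set j | syndrome x j != syndrome c j]|.
  by apply: eq_card => j; rewrite !inE ct.
exact: syndrome_dist_le.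
Qed.

(** * Codeword counts as functions of the distances to constant tuples *)

Lemma codewords_at0 v :
  (codewords_at C 0 v)%:R =
  \sum_t (dist_const t (syndrome v) == 0%N)%:R :> rat.
Proof.
have dP t : (dist_const t (syndrome v) == 0%N) = [forall j, syndrome v j == t].
  rewrite cards_eq0; apply/eqP/forallP => [/setP e j|e].
    by have := e j; rewrite !inE => /negbFE.
  by apply/setP => j; rewrite !inE e.
have -> : codewords_at C 0 v = (v \in C).
  rewrite /codewords_at; case: (boolP (v \in C)) => vC.
    rewrite -[RHS](cards1 v); apply: eq_card => c.
    rewrite in_set in_set1 hamming_dist_eq0 (eq_sym v).
    by case: (c =P v) => [->|_]; rewrite ?vC ?andbF.
  apply/eqP; rewrite cards_eq0; apply/eqP/setP => c; rewrite in_set0 in_set.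
  rewrite hamming_dist_eq0; case: (v =P c) => [<-|_]; last by rewrite andbF.
  by rewrite (negPf vC).
rewrite (bigD1 (syndrome v ord0)) //= big1 ?addr0 => [|t tv].
  congr (nat_of_bool _)%:R; rewrite dP; apply/mem_codeP/forallP => [[t vt] j|e].
    by rewrite !vt.
  by exists (syndrome v ord0) => j; apply/eqP.
by rewrite dP; case: forallP => // /(_ ord0); rewrite eq_sym (negPf tv).
Qed.

(** [psi] is the same for all [v]; vanishing above [k] and value 1 at [k] make the system of counts
    unitriangular. *)
Definition profile k := exists psi : nat -> rat,
  [/\ forall v, (codewords_at C k v)%:R = \sum_t psi (dist_const t (syndrome
    v)),
      forall r, (k < r)%N -> psi r = 0 & psi k = 1].

Lemma codewords_at_profile k : profile k.
Proof.
(* The recurrence reaches back two indices, so two consecutive profiles are carried along. *)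
suff: profile k.-1 /\ profile k by case.
elim: k => [|k [/= [psi0 [E0 z0 _]] Pk]].
  have P0 : profile 0.
    exists (fun r => (r == 0%N)%:R); split=> //; first exact: codewords_at0.
    by case.
  by [].
split=> //; have [psi [E z one]] := Pk.
set N := #|{: 'cV[F]_m}|.
set u := (k * #|F|.-2)%N.
set u0 := ((0 < k) * ((na * nb - k.-1) * #|F|.-1))%N.
(* This is [codewords_at_rec] with the neighbour sum evaluated by [sum_dist_const_shift]. At
   [r = k.+1] only [psi r.-1 *+ r] survives, and it equals [k.+1]. *)
exists (fun r => (psi r.+1 *+ ((nb - r) * N.-1) + psi r.-1 *+ r
          + psi r *+ (r * N.-2) - psi r *+ u - psi0 r *+ u0) / k.+1%:R).
have k0 : k.+1%:R != 0 :> rat by rewrite pnatr_eq0.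
split=> [v|r kr|].
- apply: (mulIf k0); rewrite mulr_natr codewords_at_rec -mulr_suml divfK //.
  rewrite !sumrB !sumrMnl -E -E0; congr (_ - _ - _).
  under eq_bigr do rewrite E.
  rewrite exchange_big /=; apply: eq_bigr => t _.
  rewrite (sum_neighbors_syndrome (fun s => psi (dist_const t s))).
  by rewrite sum_dist_const_shift card_ord.
- by rewrite !z ?z0 ?mul0rn ?addr0 ?subr0 ?mul0r //; lia.
- rewrite /= one z ?(z k.+1) ?z0 ?mul0rn ?add0r ?addr0 ?subr0 ?divff //; lia.
Qed.

(** Triangular elimination: subtracting [phi k] times the profile function of index [k] clears the
    value at [k] and shortens the support. *)
Lemma codewords_at_span k (phi : nat -> rat) :
  (forall r, (k <= r)%N -> phi r = 0) ->
  exists alpha : nat -> rat, forall v,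
    \sum_(i < k) alpha i * (codewords_at C i v)%:R =
    \sum_t phi (dist_const t (syndrome v)).
Proof.
elim: k phi => [|k IH] phi hphi.
  by exists (fun=> 0) => v; rewrite big_ord0 big1 // => t _; rewrite hphi.
have [psi [E z one]] := codewords_at_profile k.
have [r|alpha halpha] := IH (fun r => phi r - phi k * psi r).
  rewrite leq_eqVlt => /predU1P[<-|kr]; first by rewrite one mulr1 subrr.
  by rewrite z // hphi // mulr0 subr0.
exists (fun i => if i == k then phi k else alpha i) => v.
rewrite big_ord_recr /= eqxx E.
rewrite (eq_bigr (fun i : 'I_k => alpha i * (codewords_at C i v)%:R)).
  by rewrite halpha sumrB -mulr_sumr subrK.
by move=> i _; rewrite ltn_eqF.
Qed.

(** * Covering radius and uniform packing *)

Hypothesis hnb : (nb <= #|F| ^ m)%N.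

Lemma exists_injective_syndrome : exists g : 'I_nb -> 'cV[F]_m, injective g.
Proof.
have hN : (nb <= #|{: 'cV[F]_m}|)%N by rewrite card_mx muln1.
by exists (fun j => enum_val (widen_ord hN j)) => i j /enum_val_inj[] /val_inj.
Qed.

(** The constant given by the first block agrees with the tuple at least once. A tuple with distinct
    entries, available by [hnb], agrees with each constant at most once. *)
Lemma covering_radius_code : covering_radius C = b.
Proof.
apply/eqP; rewrite eqn_leq; apply/andP; split.
  apply/bigmax_leqP => v _.
  apply: leq_trans (dist_to_code_le v (syndrome v ord0)) _.
  rewrite -ltnS -[X in (_ < X)%N](card_ord nb) -cardsT; apply: proper_card.
  by apply/properP; split; [exact: subsetT|exists ord0; rewrite !inE ?eqxx].
have [g gi] := exists_injective_syndrome.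
have [x sx] := exists_syndrome [ffun j => g j].
apply: leq_trans (leq_bigmax x).
have [t ->] := dist_to_codeP x.
suff : (#|[set j | syndrome x j == t]| <= 1)%N.
  by rewrite dist_const_compl card_ord leq_subLR addn1 ltnS.
apply/card_le1P => i; rewrite !inE sx ffunE => /eqP gt j.
by rewrite !inE ffunE -gt (inj_eq gi).
Qed.

Lemma uniformly_packed_code : uniformly_packed_wide C.
Proof.
(* Truncated subtraction makes this function vanish from [nb] on. *)
have [r|alpha halpha] := @codewords_at_span nb (fun r => (nb - r)%N%:R / nb%:R).
  by rewrite -subn_eq0 => /eqP ->; rewrite mul0r.
exists (fun k => alpha k) => v.
rewrite -(big_mkord xpredT (fun k => alpha k * (codewords_at C k v)%:R)).
rewrite covering_radius_code big_mkord halpha -mulr_suml -natr_sum.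
rewrite -[X in \sum_t (X - _)%N](card_ord nb) sum_dist_const_compl card_ord
  divff //.
by rewrite pnatr_eq0.
Qed.

(** * Dimension and minimum distance *)

Lemma dim_code : exists V : {vspace 'rV[F]_(na * nb)},
  C =i V /\ \dim V = (na * nb - m * (nb - 1))%N.
Proof.
set M := H *t repetition_pcm F nb.
pose f : 'Hom('rV[F]_(na * nb), 'rV[F]_(m * (nb - 1))) := linfun (mulmxr M^T).
exists (lker f); split.
  move=> x; rewrite memv_ker inE lfunE /= -[in RHS](trmxK x) -trmx_mul.
  by rewrite -(inj_eq trmx_inj) trmx0.
have := limg_ker_dim f fullv; rewrite capfv.
have -> : limg f = fullv.
  apply/vspaceP => z; rewrite memvf; apply/memv_imgP.
  (* For surjectivity, the blocks before the last take the columns of [z] as syndromes; on the last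
     one [insub] fails and the default 0 is used, so differences with it return [z]. *)
  pose s : {ffun 'I_nb -> 'cV[F]_m} := [ffun j : 'I_nb => \col_r
    oapp (fun p : 'I_(nb - 1) => z 0 (mxtens_index (r, p))) 0 (insub (j :
      nat))].
  have [x sx] := exists_syndrome s; exists x; first exact: memvf.
  rewrite lfunE /=; apply: trmx_inj; rewrite trmx_mul trmxK.
  apply/matrixP => k e; rewrite (ord1 e); case: (mxtens_indexP k) => r p.
  rewrite pcm_mul_syndrome sx !ffunE !mxE /= valK /= insubF /= ?subr0 //.
  by rewrite subn1 ltnn.
rewrite !dimvf !dim_matrix !mul1r => e.
by rewrite -[LHS](addnK (m * (nb - 1))%N) [X in (X - _)%N]e.
Qed.

(** With at least three blocks, two changed letters leave some block untouched, so the common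
    syndrome stays the same and the changes must cancel within each block. Neither one letter nor
    two letters at independent columns can cancel. *)
Lemma code_dist_ge3 x y : (2 < nb)%N ->
  x \in C -> y \in C -> x != y -> (3 <= hamming_dist x y)%N.
Proof.
move=> nb2 /mem_codeP[t xt] /mem_codeP[t' yt'] xy; rewrite leqNgt; apply/negP.
have w0 i a : a != 0 -> a *: col i H != 0.
  by move=> a0; rewrite scaler_eq0 negb_or a0 (proj1 hH).
case E : (hamming_dist x y) => [|[|[|//]]] _.
- by move/eqP: E; rewrite hamming_dist_eq0 (negPf xy).
- have [p [a [a0 /eqP]]] := hamming_distS E.
  rewrite hamming_dist_eq0 => /eqP e _; case: (mxtens_indexP p) e => i j e.
  have [k [kj _]] := exists_avoid2 j j nb2.
  have := yt' k; have := yt' j; rewrite -e syndrome_delta !shift_atE eqxx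
    (negPf kj).
  rewrite !xt => <- /eqP; rewrite eq_sym -subr_eq0 addrC addKr.
  by rewrite (negPf (w0 i a a0)).
have [p [a [a0 E1 xp]]] := hamming_distS E.
have [p' [a' [a'0 /eqP]]] := hamming_distS E1.
rewrite hamming_dist_eq0 => /eqP e xp'.
have pp' : p' != p.
  apply: contraNneq a'0 => pp'; move: xp'; rewrite pp' -xp !mxE !eqxx mulr1.
  by rewrite -[X in _ = X]addr0 => /addrI ->.
case: (mxtens_indexP p) pp' e {xp E1 xp'} => i j.
case: (mxtens_indexP p') => i' j' pp' e.
have [k [/negPf kj /negPf kj']] := exists_avoid2 j j' nb2.
have := yt' k; have := yt' j.
rewrite -e !syndrome_delta !shift_atE eqxx kj kj' !xt.
have [jj'|jj'] := eqVneq j j' => <-;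
    rewrite -?addrA -[X in X = _ -> _]addr0 => /addrI /eqP; rewrite eq_sym.
  rewrite addr_eq0 -scaleNr => /eqP /(hamming_columns_inj hH a0)[ii' _].
  by rewrite ii' jj' eqxx in pp'.
by rewrite (negPf (w0 i a a0)).
Qed.

(** A Hamming codeword of weight three is placed in block 0: the sum of two columns is nonzero,
    hence a multiple of a column, which independence makes a third one. *)
Lemma code_dist_eq3 : (1 < na)%N ->
  exists x y, [/\ x \in C, y \in C, x != y & hamming_dist x y = 3%N].
Proof.
move=> na1; pose i0 : 'I_na := Ordinal (ltnW na1);
  pose i1 : 'I_na := Ordinal na1.
have sep i j (c c' : F) : i != j -> c != 0 -> c *: col i H != c' *: col j H.
  move=> ij c0; apply: contraNneq ij => /(hamming_columns_inj hH c0)[-> _].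
  exact: eqxx.
have i01 : i0 != i1 by [].
have : col i0 H + col i1 H != 0.
  rewrite addr_eq0 -scaleN1r -[col i0 H]scale1r; apply: sep => //.
  exact: oner_neq0.
case/(hamming_column_decode hH hcard) => i2 [a [a0 e]].
have i02 : i0 != i2.
  apply: contraNneq i01 => i02; move/eqP: e;
    rewrite -i02 addrC -subr_eq0 -addrA.
  rewrite -[X in X - _]scale1r -scalerBl addr_eq0 -scaleNr -[col i1 H]scale1r.
  by move/eqP/(hamming_columns_inj hH (oner_neq0 _))=> [->].
have i12 : i1 != i2.
  apply: contraNneq i01 => i12; move/eqP: e; rewrite -i12 -subr_eq0 -addrA.
  rewrite -[X in X - _]scale1r -scalerBl addr_eq0 -scaleNr -[col i0 H]scale1r.
  by move/eqP/(hamming_columns_inj hH (oner_neq0 _))=> [->].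
pose p (i : 'I_na) : 'I_(na * nb) := mxtens_index (i, ord0).
have peq i j : (p i == p j) = (i == j).
  by rewrite (can_eq (@mxtens_indexK _ _)) xpair_eqE eqxx andbT.
pose y := 0 + 1 *: delta_mx 0 (p i0) + 1 *: delta_mx 0 (p i1) +
  (- a) *: delta_mx 0 (p i2) : 'rV[F]_(na * nb).
have s0 : syndrome 0 = [ffun=> 0].
  by apply/ffunP => j; rewrite !ffunE big1 // => i _; rewrite mxE scale0r.
have d3 : hamming_dist 0 y = 3%N.
  transitivity #|[set p i0; p i1; p i2]|.
    apply: eq_card => k; rewrite !inE !mxE eqxx !mul1r add0r /= eq_sym.
    have [->|k0] := eqVneq k (p i0).
      by rewrite !peq (negPf i01) (negPf i02) !addr0 mulr0 addr0 oner_eq0.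
    have [->|k1] := eqVneq k (p i1).
      by rewrite !peq (negPf i12) add0r mulr0 addr0 oner_eq0.
    rewrite !add0r; case: (k =P p i2) => _; first by rewrite mulr1 oppr_eq0 a0.
    by rewrite mulr0 eqxx.
  rewrite -setUA !cardsU1 cards1 !inE !peq.
  by rewrite (negPf i01) (negPf i02) (negPf i12).
exists 0, y; split=> //; last by rewrite -hamming_dist_eq0 d3.
  by apply/mem_codeP; exists 0 => j; rewrite s0 ffunE.
apply/mem_codeP; exists 0 => j; rewrite !syndrome_delta s0 !ffunE.
by case: eqP => // _; rewrite !scale1r add0r e scaleNr subrr.
Qed.

(** * Shells in terms of syndromes and failure of complete regularity *)

Lemma dist_to_code_eq x l :
  (dist_to_code x C == l) =
  [exists t, dist_const t (syndrome x) == l] &&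
  [forall t, l <= dist_const t (syndrome x)]%N.
Proof.
have [t dt] := dist_to_codeP x.
apply/eqP/andP => [<-|[/existsP[t' /eqP <-] /forallP h]].
  split; first by apply/existsP; exists t; rewrite dt.
  by apply/forallP => t'; exact: dist_to_code_le.
by apply/eqP; rewrite eqn_leq dist_to_code_le //= dt h.
Qed.

(** Changing entry [j] lowers the distance only to the constant equal to the new entry [s j + w],
    and by exactly one. *)
Lemma shell_decrease s l j w : w != 0 ->
  (forall t, l.+1 <= dist_const t s)%N ->
  [exists t, dist_const t (shift_at s j w) == l] &&
  [forall t, l <= dist_const t (shift_at s j w)]%N =
  (dist_const (s j + w) s == l.+1).
Proof.
move=> w0 ls; have sw : s j != s j + w.
  by rewrite eq_sym -subr_eq0 addrC addKr.
apply/andP/eqP => [[/existsP[t /eqP dt] _]|dw].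
  have := dist_const_shift t s j w; have := ls t; rewrite dt.
  by case: (s j + w =P t) => [->|_]; case: (s j != t) => /=; lia.
split; last first.
  apply/forallP => t; have := dist_const_shift t s j w; have := ls t.
  by case: (s j != t); case: (_ != t); lia.
apply/existsP; exists (s j + w); have := dist_const_shift (s j + w) s j w.
by rewrite eqxx sw dw; lia.
Qed.

(** For each nearest constant [t] at distance [l.+1], moving inward means replacing one of the
    [l.+1] entries different from [t] by [t]. *)
Lemma neighbors_in_inner_shell x l :
  (forall t, l.+1 <= dist_const t (syndrome x))%N ->
  neighbors_in (code_shell C (l.+1%:Z - 1)) x =
  (l.+1 * #|[set t | dist_const t (syndrome x) == l.+1]|)%N.
Proof.
move=> lx; set s := syndrome x.
transitivity (\sum_(y | hamming_dist x y == 1%N)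
  ([exists t, dist_const t (syndrome y) == l] &&
   [forall t, l <= dist_const t (syndrome y)] : nat))%N.
  rewrite /neighbors_in -sum1_card big_mkcond [RHS]big_mkcond.
  apply: eq_bigr => y _; rewrite !inE -dist_to_code_eq.
  have -> : ((dist_to_code y C)%:Z == l.+1%:Z - 1) = (dist_to_code y C == l).
    by lia.
  by case: eqP; case: eqP.
rewrite (sum_neighbors_syndrome (fun s =>
  ([exists t, dist_const t s == l] && [forall t, l <= dist_const t s]%N :
    nat))).
transitivity (\sum_j \sum_(t | t != s j) (dist_const t s == l.+1 : nat))%N.
  apply: eq_bigr => j _; rewrite [RHS](reindex_inj (addrI (s j))) /=.
  apply: eq_big => [w|w w0].
    by rewrite -[in RHS]subr_eq0 [in RHS]addrC addKr.
  by rewrite shell_decrease.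
under eq_bigr do rewrite big_mkcond.
rewrite exchange_big -sum1dep_card big_distrr [RHS]big_mkcond /=.
apply: eq_bigr => t _; rewrite -big_mkcond sum_nat_const.
case: eqP => [<-|_]; last by rewrite muln0.
by rewrite !muln1 /dist_const -cardsE; apply: eq_card => j; rewrite !inE eq_sym.
Qed.

Lemma not_completely_regular_code : (3 < nb)%N -> ~ completely_regular C.
Proof.
move=> nb3 reg; have [g gi] := exists_injective_syndrome.
(* Thus [l.+1] is [nb - 2], the distance to the code when values are repeated at most twice and some
   value is. *)
pose l := b.-2; have bl : b = l.+2 by rewrite /l; lia.
pose o k : 'I_nb := inord k.
have oE i j : (i <= 3)%N -> (j <= 3)%N -> (o i == o j) = (i == j).
  by move=> i3 j3; rewrite -val_eqE /= !inordK //; lia.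
(* Index 1 is merged into 0 and, when [e] holds, also 3 into 2, so [s false] has one repeated value
   and [s true] has two. *)
pose h (e : bool) (j : 'I_nb) : 'I_nb :=
  if j == o 1%N then o 0%N else if e && (j == o 3%N) then o 2%N else j.
pose s e : {ffun 'I_nb -> 'cV[F]_m} := [ffun j => g (h e j)].
have sE e k : [set j | s e j == g k] = [set j | h e j == k].
  by apply/setP => j; rewrite !inE ffunE (inj_eq gi).
have h0 e : #|[set j | h e j == o 0%N]| = 2%N.
  transitivity #|[set o 0%N; o 1%N]|; last by rewrite cards2 oE.
  apply: eq_card => j; rewrite !inE /h; have [->|j1] := eqVneq j (o 1%N).
    by rewrite eqxx orbT.
  by rewrite orbF; case: ifP => // /andP[_ /eqP ->]; rewrite !oE.
have h2 : #|[set j | h true j == o 2%N]| = 2%N.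
  transitivity #|[set o 2%N; o 3%N]|; last by rewrite cards2 oE.
  apply: eq_card => j; rewrite !inE /h; have [->|j1] := eqVneq j (o 1%N).
    by rewrite !oE.
  by have [->|j3] := eqVneq j (o 3%N); rewrite /= ?eqxx ?orbT ?orbF.
have h1 e k : k != o 0%N -> ~~ (e && (k == o 2%N)) ->
    (#|[set j | h e j == k]| <= 1)%N.
  move=> k0 k2; rewrite -[X in (_ <= X)%N](cards1 k);
    apply/subset_leq_card/subsetP => j.
  rewrite !inE /h; case: ifP => _; first by rewrite eq_sym (negPf k0).
  case: ifP => // /andP[e1 _] k2'; case/negP: k2.
  by rewrite e1 eq_sym.
have mult e t : (2 <= #|[set j | s e j == t]|)%N ->
    t = g (o 0%N) \/ e /\ t = g (o 2%N).
  have [k /eqP <-|nk] := pickP (fun k => g k == t); last first.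
    rewrite (_ : [set j | _] = set0) ?cards0 //.
    by apply/setP => j; rewrite !inE ffunE nk.
  rewrite sE => k2; have [->|k0] := eqVneq k (o 0%N); first by left.
  right; have [/andP[-> /eqP ->]//|ek] := boolP (e && (k == o 2%N)).
  by have := h1 e k k0 ek; lia.
have mult2 e t : (#|[set j | s e j == t]| <= 2)%N.
  rewrite leqNgt; apply/negP => h3; have := h3.
  case: (mult e t (ltnW h3)) => [->|[e1 ->]]; rewrite sE ?h0 //.
  by rewrite e1 h2.
have dE e t : dist_const t (s e) = (l.+3 - #|[set j | s e j == t]|)%N.
  rewrite dist_const_compl card_ord -bl subKn //.
  by rewrite -[X in (_ <= X)%N](card_ord nb) dist_const_le.
have ls e t : (l.+1 <= dist_const t (s e))%N.
  by rewrite dE; have := mult2 e t; lia.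
have d0 e : dist_const (g (o 0%N)) (s e) = l.+1 by rewrite dE sE h0.
have d2 : dist_const (g (o 2%N)) (s true) = l.+1 by rewrite dE sE h2.
have xe e : exists x, syndrome x = s e by exact: exists_syndrome.
have [x sx] := xe false; have [y sy] := xe true.
have shell e z : syndrome z = s e -> z \in code_shell C l.+1%:Z.
  move=> sz; rewrite inE eqz_nat dist_to_code_eq sz; apply/andP; split.
    by apply/existsP; exists (g (o 0%N)); rewrite d0.
  by apply/forallP.
have [+ _] := reg _ _ _ (shell _ _ sx) (shell _ _ sy).
have lx t : (l.+1 <= dist_const t (syndrome x))%N by rewrite sx.
have ly t : (l.+1 <= dist_const t (syndrome y))%N by rewrite sy.
rewrite (neighbors_in_inner_shell lx) (neighbors_in_inner_shell ly) sx sy =>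
  /eqP.
rewrite eqn_pmul2l // => /eqP card_eq.
have : (#|[set t | dist_const t (s false) == l.+1]| <= 1)%N.
  rewrite -[X in (_ <= X)%N](cards1 (g (o 0%N)));
    apply/subset_leq_card/subsetP => t.
  rewrite !inE => /eqP dt; suff: (2 <= #|[set j | s false j == t]|)%N.
    by case/mult => [->|[]].
  by move: dt; rewrite dE; lia.
rewrite card_eq leqNgt => /negP; apply.
have <- : #|[set g (o 0%N); g (o 2%N)]| = 2%N by rewrite cards2 (inj_eq gi) oE.
apply/subset_leq_card/subsetP => t; rewrite !inE.
by case/orP => /eqP ->; rewrite ?d0 ?d2.
Qed.

End Syndrome.

(** * Specialization to the length of the Hamming code *)

Theorem theorem5p1 (q u m na nb : nat) (Fq FQ : finFieldType)
    (iota : {rmorphism Fq -> FQ}) (H : 'M[FQ]_(m, na))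
    (hq : #|Fq| = q) (hQ : #|FQ| = (q ^ u)%N)
    (hu : (1 <= u)%N) (hm : (2 <= m)%N)
    (hna : na = ((q ^ (u * m) - 1) %/ (q ^ u - 1))%N)
    (hH : hamming_columns H)
    (hnb4 : (4 <= nb)%N) (hnb : (nb <= (q ^ u - 1) * na + 1)%N) :
  let C : {set 'rV[FQ]_(na * nb)} :=
    parity_check_code (H *t map_mx iota (repetition_pcm Fq nb)) in
  [/\ uniformly_packed_wide C,
      linear_code_params C (na * nb - m * (nb - 1)) 3
    & covering_radius C = (nb - 1)%N]
  /\ ~ completely_regular C.
Proof.
have Q1 : (1 < #|FQ|)%N by exact: finNzRing_gt1.
(* The quotient in [hna] is exact, by the geometric sum. *)
have hcard : (na * #|FQ|.-1 = (#|FQ| ^ m).-1)%N.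
  have Q0 : (0 < #|FQ|.-1)%N by lia.
  by rewrite hna expnM -hQ !subn1 predn_exp mulKn // mulnC.
have QQm : (#|FQ| < #|FQ| ^ m)%N by rewrite -[X in (X < _)%N]expn1 ltn_exp2l.
have na1 : (1 < na)%N.
  rewrite ltnNge; apply/negP => na1.
  have : (na * #|FQ|.-1 <= #|FQ|.-1)%N by rewrite -[leqRHS]mul1n leq_mul2r na1
    orbT.
  by rewrite hcard; lia.
(* By [hcard] the upper bound on [nb] is the number of syndromes. *)
have {}hnb : (nb <= #|FQ| ^ m)%N.
  by move: hnb; rewrite -hQ subn1 mulnC hcard; lia.
rewrite map_repetition_pcm; case: nb hnb4 hnb => // b hb hnb C.
split; last exact: not_completely_regular_code.
split.
- exact: uniformly_packed_code.
- split; first exact: dim_code.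
  split; first exact: code_dist_eq3.
  by move=> x y; apply: code_dist_ge3 => //; apply: ltnW.
- by rewrite /C covering_radius_code // subn1.
Qed.
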